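(* Let $p$ be a prime, let $c \geq 1$ be an integer, and let $G$ be a $p$-group of order $p^n$. Then the order of the $c$-nilpotent multiplier $M^{(c)}(G)$ is at most $p^{\chi_{c+1}(n)}$, where $\chi_{c+1}(n)$ is the number of basic commutators of weight $c+1$ on $n$ generators.
   Context: For a group $G$ with a free presentation $1 \to R \to F \to G \to 1$ ($F$ free, $R$ normal in $F$), the $c$-nilpotent multiplier of $G$ is the abelian group $$M^{(c)}(G) = \frac{R \cap \gamma_{c+1}(F)}{[R,\,_cF]},$$ where $\gamma_{c+1}(F)$ is the $(c+1)$st term of the lower central series of $F$ (with $\gamma_1(F)=F$), $[R,\,_1F]=[R,F]$ and $[R,\,_cF]=[[R,\,_{c-1}F],F]$ for $c \geq 2$. Up to isomorphism it does not depend on the choice of the free presentation. (For $c=1$ it is the Schur multiplier $M(G)$.) The number $\chi_m(d)$ of basic commutators of weight $m$ on $d$ letters is given by the Witt formula $\chi_m(d) = \frac{1}{m}\sum_{k \mid m} \mu(k)\, d^{m/k}$, where $\mu$ is the Möbius function. Basic commutators on ordered letters $x_1<x_2<\cdots<x_d$ are defined as follows: the letters are the basic commutators of weight one; a commutator $[c_i,c_j]$ is a basic commutator of weight $k$ if $c_i,c_j$ are basic commutators of weights less than $k$ with $wt(c_i)+wt(c_j)=k$, $c_i>c_j$, and, whenever $c_i=[c_s,c_t]$, $c_j\geq c_t$; the order is extended so that commutators of larger weight are larger, with any fixed order among those of equal weight. *)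

(* Defs.v *)
From HB Require Import structures.
From mathcomp Require Import all_boot all_fingroup finmap.
From mathcomp Require Import boolp classical_sets functions cardinality.

Set Implicit Arguments.
Unset Strict Implicit.
Unset Printing Implicit Defensive.

Local Open Scope classical_set_scope.
Local Open Scope group_scope.

Definition generated (F : groupType) (S : set F) : set F :=
  smallest [set A : set F | group_closed [in A]] S.

Definition commutator_subgroup (F : groupType) (A B : set F) : set F :=
  generated [set z | exists x y, [/\ A x, B y & z = [~ x, y]]].

(* iterated_commutator A k = [A, _k F]; for k = 0 this is A itself. *)
Fixpoint iterated_commutator (F : groupType) (A : set F) (k : nat) : set F :=
  if k is k'.+1 then commutator_subgroup (iterated_commutator A k') setT else A.

(* Numbered from 1, as gamma_1(F) = F; the index 0 is a dummy with value F. *)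
Definition lower_central (F : groupType) (k : nat) : set F :=
  iterated_commutator setT k.-1.
Arguments lower_central : clear implicits.

(* F is free on the family i, by the universal property. *)
Definition free_on (F : groupType) (X : Type) (i : X -> F) : Prop :=
  forall (H : groupType),
    (forall f : X -> H,
       exists phi : {multiplicative F -> H}, forall x, phi (i x) = f x) /\
    (forall phi psi : {multiplicative F -> H},
       (forall x, phi (i x) = psi (i x)) -> forall y, phi y = psi y).

Definition hom_kernel (F H : groupType) (pi : {multiplicative F -> H}) : set F :=
  [set x | pi x = 1].

Definition free_presentation (gT : finGroupType) (G : {group gT})
    (F : groupType) (pi : {multiplicative F -> gT}) : Prop :=
  (exists (X : Type) (i : X -> F), free_on i) /\ range pi = [set` G].

(* The underlying set of the quotient A / B. *)
Definition quotient_cosets (F : groupType) (A B : set F) : set (set F) :=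
  [set [set x * b | b in B] | x in A].

Definition nilpotent_multiplier (c : nat) (gT : finGroupType)
    (F : groupType) (pi : {multiplicative F -> gT}) : set (set F) :=
  quotient_cosets (hom_kernel pi `&` lower_central F c.+1)
                  (iterated_commutator (hom_kernel pi) c).

(* Formal commutators in the letters x_0 < ... < x_(d-1). *)
Inductive bracket (d : nat) : Type :=
  | Letter of 'I_d
  | Br of bracket d & bracket d.

Section BracketCountable.
Variable d : nat.

Fixpoint bracket_code (t : bracket d) : GenTree.tree 'I_d :=
  match t with
  | Letter i => GenTree.Leaf i
  | Br u v => GenTree.Node 0 [:: bracket_code u; bracket_code v]
  end.

Fixpoint bracket_decode (t : GenTree.tree 'I_d) : option (bracket d) :=
  match t with
  | GenTree.Leaf i => Some (Letter i)
  | GenTree.Node _ [:: u; v] =>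
      if (bracket_decode u, bracket_decode v) is (Some u', Some v')
      then Some (Br u' v') else None
  | _ => None
  end.

Lemma bracket_codeK : pcancel bracket_code bracket_decode.
Proof. by elim=> [i|u IHu v IHv] //=; rewrite IHu IHv. Qed.

HB.instance Definition _ := Countable.copy (bracket d) (pcan_type bracket_codeK).

End BracketCountable.

Fixpoint wt (d : nat) (t : bracket d) : nat :=
  match t with Letter _ => 1 | Br u v => wt u + wt v end.

(* The order is taken total on all formal commutators; only its restriction
   to the basic ones matters below. *)
Definition commutator_order (d : nat) (le : rel (bracket d)) : Prop :=
  [/\ total le, antisymmetric le, transitive le,
      forall i j : 'I_d, le (Letter i) (Letter j) = (i <= j)%N
    & forall u v, (wt u < wt v)%N -> le u v].

(* le being total, c_i > c_j reads ~~ le c_i c_j. *)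
Fixpoint basic (d : nat) (le : rel (bracket d)) (t : bracket d) : bool :=
  match t with
  | Letter _ => true
  | Br ci cj =>
      [&& basic le ci, basic le cj, ~~ le ci cj
        & if ci is Br cs ct then le ct cj else true]
  end.

Definition basic_commutators (d : nat) (le : rel (bracket d)) (m : nat) :
    set (bracket d) :=
  [set t | basic le t /\ wt t = m].

(* fset_set is set-theoretic only on finite sets; see basic_commutators_finite. *)
Definition chi (d : nat) (le : rel (bracket d)) (m : nat) : nat :=
  #|` fset_set (basic_commutators le m)|.

Lemma wt_gt0 (d : nat) (t : bracket d) : (0 < wt t)%N.
Proof. by elim: t => //= u hu v _; rewrite addn_gt0 hu. Qed.

Lemma bracket_le_finite (d m : nat) :
  finite_set [set t : bracket d | (wt t <= m)%N].
Proof.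
elim: m => [|m IHm].
  apply: (sub_finite_set _ (@finite_set0 (bracket d))) => t /=.
  by rewrite leqNgt wt_gt0.
pose S := [set t : bracket d | (wt t <= m)%N].
apply: (@sub_finite_set _ _
  (range (@Letter d) `|` (fun p => Br p.1 p.2) @` (S `*` S))).
  case=> [i|u v] /= h; first by left; exists i.
  right; exists (u, v) => //; split; rewrite /S /=.
    by rewrite -ltnS (leq_trans _ h) // -addn1 leq_add2l wt_gt0.
  by rewrite -ltnS (leq_trans _ h) // -add1n leq_add2r wt_gt0.
rewrite finite_setU; split; apply: finite_image; last exact: finite_setX.
exact: finite_finset.
Qed.

Lemma basic_commutators_finite (d : nat) (le : rel (bracket d)) (m : nat) :
  finite_set (basic_commutators le m).
Proof.
by apply: sub_finite_set (@bracket_le_finite d m) => t [_ <-] /=.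
Qed.

Lemma commutator_order_exists (d : nat) :
  exists le : rel (bracket d), commutator_order le.
Proof.
pose key (t : bracket d) : nat :=
  if t is Letter i then val i else choice.pickle t.
have key_inj u v : wt u = wt v -> key u = key v -> u = v.
  case: u v => [i|u1 u2] [j|v1 v2] //= h.
  - by move=> /val_inj ->.
  - by move: h (leq_add (wt_gt0 v1) (wt_gt0 v2)) => <-.
  - by move: h (leq_add (wt_gt0 u1) (wt_gt0 u2)) => ->.
  - by move=> /(pcan_inj choice.pickleK).
exists [rel u v | (wt u < wt v)%N || (wt u == wt v) && (key u <= key v)%N].
split=> [u v|u v|v u w|i j|u v h] /=.
- by case: ltngtP => //= _; apply: leq_total.
- case: ltngtP => //= h /andP [h1 h2]; apply: key_inj => //.
  by apply/eqP; rewrite eqn_leq h1.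
- move=> /orP [h|/andP [/eqP -> h]] /orP [h'|/andP [/eqP <- h']].
  + by rewrite (ltn_trans h h').
  + by rewrite h.
  + by rewrite h'.
  + by rewrite eqxx (leq_trans h h') orbT.
- by [].
- by rewrite h.
Qed.

(* Main.v *)
Require Import Defs.
From mathcomp Require Import all_boot all_fingroup all_solvable finmap.
From mathcomp Require Import boolp classical_sets functions cardinality.

(** Write M for the kernel of pi and S_0 = M < S_1 < ... < S_n = F for the
    preimages of a chief series of G, so that [S_(j+1), F] lies in S_j, and pick
    x_j in S_(j+1) outside S_j: then S_(j+1) = <x_j> S_j, the power x_j ^ p
    lies in S_j, and F = <x_0, ..., x_(n-1)> M. The multiplier embeds in
    gamma_(c+1)(F) / [M, _c F], a section of F filtered by the subgroups
    [S_j, _c F], with [S_n, _c F] = gamma_(c+1)(F) at the top. It is enough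
    to see that the factor [S_(i+1), _c F] / [S_i, _c F] has order at most p to
    the number of basic commutators of weight c + 1 in the x_j whose least letter
    is x_i: these numbers add up to chi.

    That factor is central in F / [S_i, _c F], because [S_(i+1), _(c+1) F] lies
    in [S_i, _c F]. Commutators of weight c + 1 in which x_i occurs are
    multilinear modulo [S_i, _c F]. Hence they generate the factor
    (sub_Vspan), have order dividing p there since x_i ^ p lies in S_i
    (N_ev_exp), and vanish there if a letter x_j with j < i occurs, since then
    x_j lies in S_i (N_ev_low).

    What remains is that the basic ones among them suffice (closed_pair_basic,
    comm_span). This is the collecting argument that shows that basic commutators
    span the free Lie ring, carried out in F itself. For basic u = [s, t] and
    v < t, the Jacobi identity replaces [[s, t], v] by brackets of [s, v] with
    t and of [t, v] with s. By induction on the weight [s, v] and [t, v] are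
    combinations of basic commutators; these are heavier than v, so larger than
    v in the order, and so are s and t. The smaller entry of the bracket has
    thus grown, which can happen only finitely often in a given weight. As
    brackets without x_i occur inside brackets with x_i, the induction follows two
    gradings at once: brackets of weight k in which x_i occurs are taken in
    [S_(i+1), _(k-1) F] modulo [S_i, _(k-1) F], and those in which it does not in
    gamma_k(F) modulo gamma_(k+1)(F). *)

Set Implicit Arguments.
Unset Strict Implicit.
Unset Printing Implicit Defensive.

Local Open Scope classical_set_scope.
Local Open Scope group_scope.
Local Open Scope card_scope.

(** * Subgroups and commutators of an arbitrary group *)

(* The bare name denotes the subgroup generated by a subset of a finite group. *)
Local Notation generated := Defs.generated.

Section Subgroups.
Variable F : groupType.
Implicit Types (x y z g : F) (A B M X Y : set F).

Definition subgroup_set A : Prop :=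
  [/\ A 1, forall x y, A x -> A y -> A (x * y) & forall x, A x -> A x^-1].

Definition normal_set A : Prop :=
  subgroup_set A /\ forall x g, A x -> A (x ^ g).

Lemma subgroup_setP A : group_closed [in A] <-> subgroup_set A.
Proof.
split=> [cA | [A1 AM AV]].
  have [A1 _] := cA; split=> [|x y Ax Ay|x Ax]; first by rewrite inE in A1.
    by have := group_closedM cA; move=> /(_ x y); rewrite !inE; apply.
  by have := group_closedV cA; move=> /(_ x); rewrite !inE; apply.
split; first by rewrite inE.
by move=> x y; rewrite !inE => Ax Ay; apply/AM/AV.
Qed.

Lemma normal_setT : normal_set [set: F].
Proof. by []. Qed.

Lemma sub_generated X : X `<=` generated X.
Proof. exact: sub_gen_smallest. Qed.

Lemma generated_min X A : subgroup_set A -> X `<=` A -> generated X `<=` A.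
Proof. by move=> /subgroup_setP; apply: smallest_sub. Qed.

Lemma subgroup_generated X : subgroup_set (generated X).
Proof.
split=> [|x y Xx Xy|x Xx] A XA; have [/subgroup_setP[A1 AM AV] _] := XA => //.
  by apply: AM; [apply: Xx | apply: Xy].
by apply: AV; apply: Xx.
Qed.

Lemma mem_commutator A B x y :
  A x -> B y -> commutator_subgroup A B [~ x, y].
Proof. by move=> Ax By; apply: sub_generated; exists x, y. Qed.

Lemma commutator_min A B M : subgroup_set M ->
  (forall x y, A x -> B y -> M [~ x, y]) -> commutator_subgroup A B `<=` M.
Proof.
by move=> sM AB_M; apply: generated_min => // z [x [y [Ax By ->]]]; apply: AB_M.
Qed.

Lemma conjg_commg x g : x ^ g = x * [~ x, g].
Proof. by rewrite mulKVg. Qed.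

Lemma commg_mull x y z : [~ x * y, z] = [~ x, z] ^ y * [~ y, z].
Proof. by rewrite !commgEr conjgM mulgA -conjMg mulgK. Qed.

Lemma commg_mulr x y z : [~ x, y * z] = [~ x, z] * [~ x, y] ^ z.
Proof. by rewrite !commgEl conjgM -mulgA -conjMg mulKVg. Qed.

Lemma hall_witt x y z :
  [~ x, y^-1, z] ^ y * [~ y, z^-1, x] ^ z * [~ z, x^-1, y] ^ x = 1.
Proof. by rewrite !commgEl !conjgE !gnorm. Qed.

Lemma normal_conj M x g : normal_set M -> M (x ^ g) -> M x.
Proof. by case=> _ MJ Mxg; rewrite -(conjgK g x); apply: MJ. Qed.

Lemma normal_commutator A B :
  normal_set A -> normal_set B -> normal_set (commutator_subgroup A B).
Proof.
move=> [_ AJ] [_ BJ]; have [C1 CM CV] := subgroup_generated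
  [set z | exists x y, [/\ A x, B y & z = [~ x, y]]].
split=> // x g; move: x.
apply: (@commutator_min A B [set x | commutator_subgroup A B (x ^ g)]).
  split=> /= [|x y Cx Cy|x Cx]; first by rewrite conj1g.
    by rewrite conjMg; apply: CM.
  by rewrite conjVg; apply: CV.
by move=> x y Ax By /=; rewrite conjRg; apply: mem_commutator; [apply: AJ|apply: BJ].
Qed.

Lemma subgroup_commgl M y : normal_set M -> subgroup_set [set x | M [~ x, y]].
Proof.
move=> [[M1 MM MV] MJ]; split=> /= [|x z Mx Mz|x Mx]; first by rewrite comm1g.
  by rewrite commg_mull; apply: MM => //; apply: MJ.
suff -> : [~ x^-1, y] = [~ x, y]^-1 ^ x^-1 by apply/MJ/MV.
by rewrite -[RHS]mulg1 -(comm1g y) -(mulgV x) commg_mull conjVg mulKg.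
Qed.

Lemma subgroup_commgr M x : normal_set M -> subgroup_set [set y | M [~ x, y]].
Proof.
move=> nM; have [M1 MM MV] := subgroup_commgl x nM; have [[_ _ MV'] _] := nM.
have sw y z : M [~ y, z] -> M [~ z, y] by rewrite -invgR => /MV'; rewrite invgK.
split=> /= [|y z /sw My /sw Mz|y /sw My]; apply: sw; first exact: M1.
  exact: MM.
exact: MV.
Qed.

Lemma commg_swap M x y : subgroup_set M -> M [~ x, y] -> M [~ y, x].
Proof. by case=> _ _ MV /MV; rewrite invgR. Qed.

Lemma commg_generated M X Y :
    normal_set M -> (forall x y, X x -> Y y -> M [~ x, y]) ->
  forall x y, generated X x -> generated Y y -> M [~ x, y].
Proof.
move=> nM XY x y Xx; move: y.
apply: (@generated_min Y [set y | M [~ x, y]]); first exact: subgroup_commgr.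
move=> y Yy; move: x Xx => /=.
apply: (@generated_min X [set x | M [~ x, y]]); first exact: subgroup_commgl.
by move=> x Xx; apply: XY.
Qed.

(** The three subgroups lemma for single elements, read off the Hall-Witt
    identity. *)
Lemma hall_witt_mem M x y z : normal_set M ->
  M [~ x, y^-1, z] -> M [~ y, z^-1, x] -> M [~ z, x^-1, y].
Proof.
move=> nM Mxyz Myzx; have [[_ MM MV] MJ] := nM.
apply: (normal_conj nM (g := x)); have := hall_witt x y z.
by move/(canRL (mulKg _)); rewrite mulg1 => ->; apply/MV/MM; apply: MJ.
Qed.

(** * The filtration by iterated commutators *)

Lemma normal_iterated A k : normal_set A -> normal_set (iterated_commutator A k).
Proof. by move=> nA; elim: k => //= k IHk; apply: normal_commutator. Qed.

Lemma commutator_mono A B X : A `<=` B ->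
  commutator_subgroup A X `<=` commutator_subgroup B X.
Proof.
move=> AB; apply: commutator_min; first exact: subgroup_generated.
by move=> x y /AB; apply: mem_commutator.
Qed.

Lemma iterated_mono A B k : A `<=` B ->
  iterated_commutator A k `<=` iterated_commutator B k.
Proof. by move=> AB; elim: k => //= k IHk; apply: commutator_mono. Qed.

Lemma iterated_shift A k :
  iterated_commutator (commutator_subgroup A setT) k = iterated_commutator A k.+1.
Proof. by elim: k => //= k ->. Qed.

(** The iterate [A, _k F] absorbs a commutator with an element of gamma_(l+1)(F)
    just as it absorbs l + 1 elements of F, by the three subgroups argument. *)
Lemma commg_iterated A k l x y : normal_set A ->
  iterated_commutator A k x -> iterated_commutator setT l y ->
  iterated_commutator A (k + l).+1 [~ x, y].
Proof.
move=> nA; elim: l => [|l IHl] in k x y *.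
  by rewrite addn0 => Ax _; apply: mem_commutator.
move=> Ax; have nM := normal_iterated (k + l.+1).+1 nA.
apply: (@commutator_min _ _ [set y | iterated_commutator A (k + l.+1).+1 [~ x, y]]).
  exact: subgroup_commgr.
move=> z f gz _ /=; have [sM _] := nM; apply: (commg_swap sM).
have [[_ _ AV] _] := normal_iterated k nA.
have [[_ _ gV] _] := normal_iterated l normal_setT.
rewrite -[f]invgK; apply: (hall_witt_mem nM).
  rewrite addnS -addSn; apply: IHl => //.
  have [sA _] := normal_iterated k.+1 nA; apply: (commg_swap sA).
  by apply: mem_commutator => //; apply: AV.
by rewrite addnS; apply: mem_commutator => //; apply: IHl => //; apply: gV.
Qed.

Lemma subgroup_exp A y a : subgroup_set A -> A y -> A (y ^+ a).
Proof.
by case=> A1 AM _ Ay; elim: a => [|a IHa]; rewrite ?expg0 // expgS; apply: AM.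
Qed.

Lemma normal_of_central M W A : subgroup_set A -> M `<=` A -> A `<=` W ->
  (forall y z, W y -> M [~ y, z]) -> normal_set A.
Proof.
move=> sA MA AW cen; split=> // y z Ay; rewrite conjg_commg.
by have [_ AM _] := sA; apply: AM => //; apply/MA/cen/AW.
Qed.

(** Modulo M, the commutator with z is additive on the powers of y as soon as
    y commutes with [y, z]. *)
Lemma commg_exp_mem M y z a : normal_set M ->
  M [~ [~ y, z], y] -> M [~ y ^+ a, z] -> M ([~ y, z] ^+ a).
Proof.
move=> nM yzy; have [[M1 MM MV] MJ] := nM; set c := [~ y, z].
suff [m Mm ->] : exists2 m, M m & [~ y ^+ a, z] = c ^+ a * m.
  by move=> Mcm; rewrite -(mulgK m (c ^+ a)); apply/MM/MV.
elim: a => [|a [m Mm IHa]]; first by exists 1; rewrite ?expg0 ?comm1g ?mulg1.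
have Mca : M [~ c, y ^+ a].
  exact: (subgroup_exp a (subgroup_commgr c nM) yzy).
exists ([~ c, y ^+ a] ^ (c ^+ a) * m); first by apply: MM => //; apply: MJ.
by rewrite expgS commg_mull IHa conjg_commg conjgE expgS !mulgA !mulgK.
Qed.

(** * Covering by few cosets *)

(** A bounded list of coset representatives stands for the index, since the
    subsets A and B of F are usually infinite. *)
Definition covered A B (m : nat) : Prop :=
  exists2 l : seq F, (size l <= m)%N &
    forall y, A y -> exists g b, [/\ g \in l, B b & y = g * b].

Lemma covered_trans A B C m m' :
  covered A B m -> covered B C m' -> covered A C (m * m').
Proof.
move=> [l lm Al] [l' lm' Bl']; exists [seq g * h | g <- l, h <- l'].
  by rewrite size_allpairs leq_mul.
move=> y /Al[g [b [gl /Bl'[h [d [hl Cd ->]]] ->]]]; exists (g * h), d.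
by rewrite mulgA; split=> //; apply: allpairs_f.
Qed.

Lemma covered_refl A m : (0 < m)%N -> covered A A m.
Proof.
by move=> m0; exists [:: 1] => // y Ay; exists 1, y; rewrite mul1g mem_head.
Qed.

Lemma covered_subl A A' B m : A `<=` A' -> covered A' B m -> covered A B m.
Proof. by move=> AA' [l lm A'l]; exists l => // y /AA'/A'l. Qed.

(** The products g ^+ a * b with b in B already form a subgroup, and g ^+ p can
    be absorbed into b. *)
Lemma covered_adjoin B g p : (0 < p)%N -> normal_set B -> B (g ^+ p) ->
  covered (generated ([set g] `|` B)) B p.
Proof.
move=> p0 nB gp; have [sB BJ] := nB; have [B1 BM BV] := sB.
exists [seq g ^+ a | a <- iota 0 p]; first by rewrite size_map size_iota.
have red a b : B b -> exists a' b', [/\ (a' < p)%N, B b' & g ^+ a * b = g ^+ a' * b'].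
  move=> Bb; exists (a %% p)%N, ((g ^+ p) ^+ (a %/ p) * b).
  split; first exact: ltn_pmod.
    by apply: BM => //; apply: subgroup_exp.
  by rewrite mulgA -expgnA -expgnDr addnC mulnC -divn_eq.
suff Bg y : generated ([set g] `|` B) y -> exists a b, B b /\ y = g ^+ a * b.
  move=> y /Bg[a [b [Bb ->]]]; have [a' [b' [ap Bb' ->]]] := red a b Bb.
  by exists (g ^+ a'), b'; split=> //; apply: map_f; rewrite mem_iota.
move: y; apply: (@generated_min _ [set y | exists a b, B b /\ y = g ^+ a * b]).
  split=> [|_ _ [a [b [Bb ->]]] [a' [b' [Bb' ->]]]|_ [a [b [Bb ->]]]].
  - by exists 0%N, 1; rewrite expg0 mulg1.
  - exists (a + a')%N, (b ^ (g ^+ a') * b'); split; first by apply: BM => //; apply: BJ.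
    by rewrite expgnDr conjgE !mulgA mulgK.
  (* g ^ - a is g ^ (a * (p - 1)) times a power of g ^ p *)
  exists (a * p.-1)%N, ((g ^+ p) ^- a * b^-1 ^ (g ^- a)); split.
    by apply: BM; [apply: BV; apply: subgroup_exp | apply: BJ; apply: BV].
  have -> : (g ^+ p) ^- a = g ^- (a * p.-1) * g ^- a.
    by rewrite -invgM -expgnDr -expgnA -mulnS prednK // mulnC.
  by rewrite conjgE !gnorm.
move=> y [-> | By]; first by exists 1%N, 1; rewrite expg1 mulg1.
by exists 0%N, y; rewrite expg0 mul1g.
Qed.

(** Modulo M the elements gs are central of exponent p, so that products of
    powers below p in a fixed order exhaust the subgroup that they generate. *)
Lemma covered_central M W p (gs : seq F) : (0 < p)%N ->
    normal_set M -> subgroup_set W -> M `<=` W ->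
    (forall y z, W y -> M [~ y, z]) ->
    (forall g, g \in gs -> W g /\ M (g ^+ p)) ->
  covered (generated ([set` gs] `|` M)) M (p ^ size gs).
Proof.
move=> p0 nM sW MW cen; elim: gs => [|g gs IHgs] gsP.
  have [sM _] := nM; apply: (@covered_subl _ M); last exact: covered_refl.
  by apply: generated_min => // y [].
set A := generated ([set` gs] `|` M).
have gsP' h : h \in gs -> W h /\ M (h ^+ p).
  by move=> hgs; apply: gsP; rewrite inE hgs orbT.
have MA : M `<=` A by move=> y My; apply: sub_generated; right.
have nA : normal_set A.
  apply: (normal_of_central (subgroup_generated _) MA) cen.
  by apply: generated_min => // y [/gsP'[] | /MW].
rewrite [size _]/= expnS; apply: (@covered_trans _ A); last exact: IHgs.
apply: (@covered_subl _ (generated ([set g] `|` A))).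
  apply: generated_min; first exact: subgroup_generated.
  move=> y [/= | My]; last by apply: sub_generated; right; apply: MA.
  rewrite inE => /predU1P[-> | ygs]; apply: sub_generated; first by left.
  by right; apply: sub_generated; left.
by apply: covered_adjoin => //; apply: MA; have [] := gsP g (mem_head _ _).
Qed.

End Subgroups.

(** * Basic commutators span *)

Section Spanning.
Variables (n : nat) (le : rel (bracket n)).
Hypothesis le_order : commutator_order le.
Variables (F : groupType) (x : 'I_n -> F) (S T : set F) (i : 'I_n).
Hypotheses (nS : normal_set S) (nT : normal_set T) (TS : T `<=` S).
Hypothesis ST : commutator_subgroup S setT `<=` T.
Hypothesis Sx : S (x i).

Fixpoint ev (b : bracket n) : F :=
  match b with Letter j => x j | Br u v => [~ ev u, ev v] end.

Fixpoint occurs (b : bracket n) : bool :=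
  match b with Letter j => j == i | Br u v => occurs u || occurs v end.

(** The flag e tells whether the letter i occurs: S and T are consecutive terms of
    the chain with x i in S, and where i does not occur the pair F, [F, F] takes
    their place. A bracket b has its value in upper_term (wt b) (occurs b), and
    counts only modulo lower_term (wt b) (occurs b). *)
Definition upper (e : bool) : set F := if e then S else setT.
Definition lower (e : bool) : set F :=
  if e then T else commutator_subgroup setT setT.

Definition upper_term (k : nat) (e : bool) := iterated_commutator (upper e) k.-1.
Definition lower_term (k : nat) (e : bool) := iterated_commutator (lower e) k.-1.

Local Notation V := upper_term.
Local Notation N := lower_term.

Lemma normal_upper e : normal_set (upper e).
Proof. by case: e. Qed.

Lemma normal_lower e : normal_set (lower e).
Proof. by case: e => //; apply: normal_commutator. Qed.

Lemma normal_V k e : normal_set (V k e).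
Proof. exact/normal_iterated/normal_upper. Qed.

Lemma normal_N k e : normal_set (N k e).
Proof. exact/normal_iterated/normal_lower. Qed.

Lemma sub_NV k e : N k e `<=` V k e.
Proof. by apply: iterated_mono; case: e. Qed.

(** Commutators one step heavier than required are negligible. This kills all
    the error terms in multilinearity. *)
Lemma sub_VSN k e : (0 < k)%N -> V k.+1 e `<=` N k e.
Proof.
case: k => // k _; rewrite /V -iterated_shift; apply: iterated_mono.
by case: e.
Qed.

Lemma sub_VT k e : V k e `<=` iterated_commutator setT k.-1.
Proof. by apply: iterated_mono. Qed.

Lemma comm_VV k l e f y z : (0 < k)%N -> (0 < l)%N ->
  V k e y -> V l f z -> V (k + l) (e || f) [~ y, z].
Proof.
suff VV k' l' f' y' z' : V k'.+1 true y' -> V l'.+1 f' z' ->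
    V (k'.+1 + l'.+1) true [~ y', z'].
  case: k l e f => [|k] [|l] // [] f // _ _; first exact: VV.
  case: f => Vy Vz /=.
    by have [s _] := normal_V (k.+1 + l.+1) true; apply: (commg_swap s);
       rewrite addnC; apply: VV Vz Vy.
  by rewrite /V addSn addnS; apply: commg_iterated.
by move=> Vy /sub_VT Vz; rewrite /V addSn addnS; apply: commg_iterated.
Qed.

(** The product of a negligible element with another one is negligible, even when
    only the second one involves i: then y lies in gamma_(k+1)(F) and z in
    [S, _(l-1) F], and the extra weight of y pays for the step from S to T. *)
Lemma comm_NV k l e f y z : (0 < k)%N -> (0 < l)%N ->
  N k e y -> V l f z -> N (k + l) (e || f) [~ y, z].
Proof.
case: k l => [|k] [|l] // _ _ Ny Vz; have [s _] := normal_N (k.+1 + l.+1) (e || f).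
case: (boolP (e || ~~ f)) => [ef | ].
  have -> : e || f = e by move: ef; case: (e); case: (f).
  rewrite /N addSn addnS /=; apply: commg_iterated => //; first exact: normal_lower.
  exact: sub_VT Vz.
case: e f => [] [] //= in s Ny Vz * => _; apply: (commg_swap s).
rewrite /N iterated_shift /= in Ny.
rewrite /N addnC addnS addSnnS /=.
apply: (@iterated_mono _ (commutator_subgroup S setT)) => //.
by rewrite iterated_shift; apply: commg_iterated.
Qed.

Definition basics (k : nat) (e : bool) : set F :=
  [set z | exists b, [/\ basic le b, wt b = k, occurs b = e & z = ev b]].

(** Containing the negligible elements makes span a normal subgroup, so that
    congruences modulo N become plain membership. *)
Definition span (k : nat) (e : bool) : set F := generated (basics k e `|` N k e).

Lemma V_ev b : V (wt b) (occurs b) (ev b).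
Proof.
elim: b => [j|u IHu v IHv] /=; last by apply: comm_VV; rewrite ?wt_gt0.
by rewrite /V /=; case: eqP => [->|].
Qed.

Lemma sub_spanV k e : span k e `<=` V k e.
Proof.
apply: generated_min; first by case: (normal_V k e).
by move=> z [[b [_ <- <- ->]] | /sub_NV //]; apply: V_ev.
Qed.

Lemma sub_Nspan k e : N k e `<=` span k e.
Proof. by move=> z Nz; apply: sub_generated; right. Qed.

Lemma comm_VN k e y z : (0 < k)%N -> V k e y -> N k e [~ y, z].
Proof.
case: k => // k _ Vy; apply: (@sub_VSN k.+1) => //.
exact: mem_commutator.
Qed.

Lemma normal_span k e : (0 < k)%N -> normal_set (span k e).
Proof.
move=> k0; apply: (@normal_of_central _ (N k e) (V k e)).
- exact: subgroup_generated.
- exact: sub_Nspan.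
- exact: sub_spanV.
- by move=> y z; apply: comm_VN.
Qed.

Lemma span_ev b : basic le b -> span (wt b) (occurs b) (ev b).
Proof. by move=> bb; apply: sub_generated; left; exists b. Qed.

(** The property to be proved of all pairs of basic brackets; it is trivial when
    Br u v is basic. *)
Definition closed_pair u v : Prop :=
  span (wt u + wt v) (occurs u || occurs v) [~ ev u, ev v].

Lemma closed_pairC u v : closed_pair u v -> closed_pair v u.
Proof.
rewrite /closed_pair addnC orbC; apply: commg_swap.
exact: subgroup_generated.
Qed.

Lemma comm_span_ev k e b y z : (0 < k)%N ->
    (forall u, basic le u -> wt u = k -> occurs u = e -> closed_pair u b) ->
  span k e y -> generated [set ev b] z -> span (k + wt b) (e || occurs b) [~ y, z].
Proof.
move=> k0 pairs; apply: commg_generated.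
  by apply: normal_span; rewrite addn_gt0 k0.
move=> y' z' [[u [bu uk ue ->]]|Ny] ->; first by rewrite -uk -ue; apply: pairs.
by apply: sub_Nspan; apply: comm_NV => //; [apply: wt_gt0 | apply: V_ev].
Qed.

Lemma comm_span_of_pairs k l e f y z : (0 < k)%N -> (0 < l)%N ->
    (forall u v, basic le u -> basic le v -> wt u = k -> wt v = l ->
       occurs u = e -> occurs v = f -> closed_pair u v) ->
  span k e y -> span l f z -> span (k + l) (e || f) [~ y, z].
Proof.
move=> k0 l0 pairs ye; have nM : normal_set (span (k + l) (e || f)).
  by apply: normal_span; rewrite addn_gt0 k0.
apply: (@generated_min _ _ [set z | span (k + l) (e || f) [~ y, z]]).
  exact: subgroup_commgr.
move=> z' [[v [bv vl vf ->]]|Nz] /=.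
  rewrite -vl -vf; apply: (comm_span_ev k0 _ ye); last exact: sub_generated.
  by move=> u bu uk ue; apply: pairs.
apply: (commg_swap (subgroup_generated _)); apply: sub_Nspan.
by rewrite addnC orbC; apply: comm_NV => //; apply: sub_spanV.
Qed.

Lemma closed_pair_trichotomy u v :
    (~~ le u v -> closed_pair u v) -> (~~ le v u -> closed_pair v u) ->
  closed_pair u v.
Proof.
have [_ anti _ _ _] := le_order.
case: (boolP (le u v)) => [uv _ | _ /(_ isT) //].
case: (boolP (le v u)) => [vu _ | _ /(_ isT)/closed_pairC //].
rewrite (anti u v) ?uv // /closed_pair commgg.
by have [[]] := @normal_span (wt v + wt v) (occurs v || occurs v)
  (ltn_addr _ (wt_gt0 v)).
Qed.

(** The Hall-Witt identity trades [[s, t], v] for brackets of [s, v] with t and of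
    [t, v] with s. Expand [s, v] and [t, v] into basic commutators by the
    hypothesis in smaller weight: these outweigh v, and v < t < s, so that all the
    brackets to be treated have both entries above v. *)
Lemma closed_pair_collect s t v :
    basic le s -> basic le t -> basic le v ->
    ~~ le t v -> ~~ le s t ->
    (forall u w, basic le u -> basic le w ->
       (wt u + wt w < wt s + wt t + wt v)%N -> closed_pair u w) ->
    (forall u w, basic le u -> basic le w -> ~~ le u v -> ~~ le w v ->
       (wt u + wt w = wt s + wt t + wt v)%N -> closed_pair u w) ->
  closed_pair (Br s t) v.
Proof.
move=> bs bt bv tv st small big; have nM : normal_set
  (span (wt s + wt t + wt v) (occurs s || occurs t || occurs v)).
  by apply: normal_span; rewrite addn_gt0 wt_gt0 orbT.
have sV k e y : span k e y -> span k e y^-1.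
  by have [_ _] := subgroup_generated (basics k e `|` N k e); apply.
have heavy a b : basic le b -> wt b = (a + wt v)%N -> (0 < a)%N -> ~~ le b v.
  move=> bb wb a0; apply/negP => bv_le; have [_ anti _ _ wlt] := le_order.
  have vb : (wt v < wt b)%N by rewrite wb -add1n leq_add2r.
  by move: (vb); rewrite -(anti b v) ?bv_le ?wlt // ltnn.
have sv : ~~ le s v.
  have [tot _ tr _ _] := le_order; apply: contra st => /tr; apply.
  by have := tot v t; rewrite (negPf tv) orbF.
have gen1 b : generated [set ev b] (ev b)^-1.
  by have [_ _] := subgroup_generated [set ev b]; apply; apply: sub_generated.
rewrite /closed_pair /= -[ev t]invgK; apply: (hall_witt_mem nM).
  rewrite -addnA addnC -orbA orbC.
  apply: (@comm_span_ev _ _ s).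
  - by rewrite addn_gt0 wt_gt0.
  - move=> b bb wb ob; apply: big => //; first exact: heavy bb wb (wt_gt0 t).
    by rewrite wb addnC addnA.
  - apply: comm_span_of_pairs; try exact: wt_gt0.
    move=> b w bb bw wb ww _ _; apply: small => //.
    by rewrite wb ww -addnA -[X in (X < _)%N]add0n ltn_add2r wt_gt0.
    by apply: sV; apply: span_ev.
    by apply: sV; apply: span_ev.
  by apply: sub_generated.
rewrite addnAC orbAC; apply: (@comm_span_ev _ _ t).
- by rewrite addn_gt0 wt_gt0.
- move=> b bb wb ob; apply: big => //; first exact: heavy bb wb (wt_gt0 s).
  by rewrite wb addnAC.
- rewrite addnC orbC; apply: comm_span_of_pairs; try exact: wt_gt0.
  + move=> b w bb bw wb ww _ _; apply: small => //.
    by rewrite wb ww [(wt v + _)%N]addnC addnAC -[X in (X < _)%N]addn0 ltn_add2l wt_gt0.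
  + exact: span_ev.
  by apply: sV; apply: span_ev.
exact: gen1.
Qed.

(** Induction on the weight m; within weight m, induction on the number of brackets
    of weight at most m above the smaller entry v. *)
Lemma closed_pair_basic u v : basic le u -> basic le v -> closed_pair u v.
Proof.
elim/ltn_ind: {u v}(wt u + wt v)%N {-2}u {-2}v (erefl (wt u + wt v)%N) => m IHm.
have [L defL] := (finite_seqP _).1 (@bracket_le_finite n m).
have [tot anti tr _ _] := le_order.
pose rank v := count (fun t => ~~ le t v) L.
have above v u : basic le v -> basic le u -> ~~ le u v ->
    (wt u + wt v)%N = m -> closed_pair u v.
  elim/ltn_ind: {v}(rank v) {-2}v (erefl (rank v)) u.
  move=> d IHd v dv u bv bu uv um.
  (* a and b may come in either order; the smaller of them exceeds v *)
  have higher a b : basic le a -> basic le b -> ~~ le a v -> ~~ le b v ->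
      (wt a + wt b)%N = m -> closed_pair a b.
    have rank_lt w : ~~ le w v -> (wt w <= m)%N -> (rank w < d)%N.
      move=> wv wm; have vw : le v w by have := tot v w; rewrite (negPf wv) orbF.
      have -> : rank w = count (fun t => ~~ le t w) [seq t <- L | ~~ le t v].
        rewrite count_filter; apply: eq_count => t /=; case: (boolP (le t w)) => //= tw.
        by apply/esym; apply: contra tw => /tr; apply.
      rewrite -dv -[X in (_ < X)%N]size_filter ltn_neqAle count_size andbT -all_count.
      apply/allPn; exists w; last by rewrite negbK; have := tot w w; rewrite orbb.
      by rewrite mem_filter wv; have : [set` L] w by rewrite -defL.
    move=> ba bb av bv' ab; apply: closed_pair_trichotomy => // h.
      by apply: (IHd (rank b)) => //; apply: rank_lt; rewrite // -ab leq_addl.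
    apply: (IHd (rank a)) => //; first by apply: rank_lt; rewrite // -ab leq_addr.
    by rewrite addnC.
  case: u bu uv um => [j|s t] bu uv um.
    by rewrite /closed_pair; apply: (@span_ev (Br (Letter j) v)); rewrite /= bv uv.
  case: (boolP (le t v)) => tv.
    by rewrite /closed_pair; apply: (@span_ev (Br (Br s t) v)) => /=; apply/and4P.
  case/and4P: bu => bs bt st _.
  apply: closed_pair_collect => // a b ba bb; rewrite um => ab; first exact: IHm ab _ _ _ _ _.
  exact: higher.
move=> u v uvm bu bv.
apply: closed_pair_trichotomy => h; apply: above => //.
by rewrite addnC.
Qed.

Lemma comm_span k l e f y z : (0 < k)%N -> (0 < l)%N ->
  span k e y -> span l f z -> span (k + l) (e || f) [~ y, z].
Proof.
by move=> k0 l0; apply: comm_span_of_pairs => // u v bu bv *; apply: closed_pair_basic.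
Qed.

Variables (R : set F) (p : nat).
Hypotheses (nR : normal_set R) (RT : R `<=` T).
Hypothesis F_gen : forall y, exists w r,
  [/\ generated (range x) w, R r & y = w * r].
Hypothesis S_gen : forall y, S y -> exists a t, T t /\ y = x i ^+ a * t.
Hypothesis x_exp : T (x i ^+ p).
Hypothesis T_low : forall j : 'I_n, (j < i)%N -> T (x j).

Fixpoint least (b : bracket n) : nat :=
  match b with Letter j => j | Br u v => minn (least u) (least v) end.

Lemma occurs_least b : occurs b -> (least b <= i)%N.
Proof.
elim: b => [j /eqP-> //|u IHu v IHv] /= /orP[/IHu|/IHv] h; rewrite geq_min h ?orbT //.
Qed.

Lemma least_occurs b : least b = i -> occurs b.
Proof.
elim: b => [j /val_inj-> /=|u IHu v IHv] //=; rewrite /minn.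
by case: ifP => _; [move=> /IHu-> | move=> /IHv->; rewrite orbT].
Qed.

(** A letter below i has its value in T, and T absorbs the remaining letters
    one commutator at a time. *)
Lemma N_ev_low b : (least b < i)%N -> N (wt b) true (ev b).
Proof.
elim: b => [j /T_low //|u IHu v IHv] /=.
rewrite gtn_min => /orP[/IHu Nu | /IHv Nv].
  exact: (comm_NV (wt_gt0 _) (wt_gt0 _) Nu (V_ev v)).
apply: (commg_swap (proj1 (normal_N _ _))); rewrite addnC.
exact: (comm_NV (wt_gt0 _) (wt_gt0 _) Nv (V_ev u)).
Qed.

Lemma N_comm_exp u v : occurs u -> N (wt u) true (ev u ^+ p) ->
  N (wt u + wt v) true ([~ ev u, ev v] ^+ p).
Proof.
move=> ou Nu; have w0 : (0 < wt u + wt v)%N by rewrite addn_gt0 wt_gt0.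
apply: commg_exp_mem; first exact: normal_N.
  apply: comm_VN => //; have := comm_VV (wt_gt0 u) (wt_gt0 v) (V_ev u) (V_ev v).
  by rewrite ou.
exact: (comm_NV (wt_gt0 u) (wt_gt0 v) Nu (V_ev v)).
Qed.

(** The exponent can be moved by multilinearity into an occurrence of the letter i,
    where x i ^+ p lies in T. *)
Lemma N_ev_exp b : occurs b -> N (wt b) true (ev b ^+ p).
Proof.
elim: b => [j /eqP-> //|u IHu v IHv] /= /orP[ou | ov].
  exact/N_comm_exp/IHu.
rewrite -invgR expVgn addnC.
by have [[_ _ NV] _] := normal_N (wt v + wt u) true; apply/NV/N_comm_exp/IHv.
Qed.

(** By multilinearity [S, _(k-1) F] is generated modulo N by commutators whose first
    entry is x i and whose other entries are letters, an entry from R being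
    negligible; comm_span brings these into span. *)
Lemma sub_Vspan k : (0 < k)%N -> V k true `<=` span k true.
Proof.
case: k => // k _; elim: k => [|k IHk].
  move=> y /S_gen[a [t [Tt ->]]]; have sA := @subgroup_generated F (basics 1 true `|` N 1 true).
  have [_ AM _] := sA; apply: AM; last exact: sub_Nspan.
  apply: (subgroup_exp a sA); have := @span_ev (Letter i) isT.
  by rewrite /= eqxx.
have nM : normal_set (span k.+2 true) by apply: normal_span.
have [[_ MM _] MJ] := nM.
apply: commutator_min; first by case: nM.
move=> y z Vy _; have [w [r [xw Rr ->]]] := F_gen z.
rewrite commg_mulr; apply: MM.
  apply: sub_Nspan; apply: (@iterated_mono _ R) => //.
  apply: (commg_swap (proj1 (normal_iterated k.+1 nR))).
  by apply: (@commg_iterated _ R 0 k) => //; apply: (@sub_VT k.+1 true).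
apply: MJ; move: w xw; apply: generated_min; first exact: subgroup_commgr nM.
move=> _ [j _ <-] /=.
have := comm_span (ltn0Sn k) (ltn0Sn 0) (IHk y Vy) (@span_ev (Letter j) isT).
by rewrite /= addn1.
Qed.

(** Of the basic commutators in which i occurs, those with a smaller letter are
    negligible, so that the ones counted here span the factor. Each basic
    commutator is thus counted at a single step of the chain, the one that belongs
    to its least letter. *)
Lemma covered_step k (L : seq (bracket n)) : (0 < p)%N -> (0 < k)%N ->
    (forall b, basic le b -> wt b = k -> b \in L) ->
    (forall b, b \in L -> wt b = k) ->
  covered (iterated_commutator S k.-1) (iterated_commutator T k.-1)
    (p ^ count (fun b => least b == i) L).
Proof.
move=> p0 k0 L_all L_wt; pose gs := [seq ev b | b <- L & least b == i].
have -> : count (fun b => least b == i) L = size gs by rewrite size_map size_filter.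
apply: (@covered_subl _ _ (generated ([set` gs] `|` N k true))).
  move=> y /(sub_Vspan k0); move: y; apply: generated_min; first exact: subgroup_generated.
  move=> y [[b [bb bk ob ->]] | Ny]; apply: sub_generated; last by right.
  have := occurs_least ob; rewrite leq_eqVlt => /orP[bi | bi]; [left | right].
    by apply: map_f; rewrite mem_filter bi L_all.
  by rewrite -bk; apply: N_ev_low.
apply: (@covered_central _ _ (V k true)) => //.
- exact: normal_N.
- by case: (normal_V k true).
- exact: sub_NV.
- by move=> y z; apply: comm_VN.
move=> g /mapP[b]; rewrite mem_filter => /andP[/eqP/least_occurs ob /L_wt bk] ->.
by rewrite -bk; split; [rewrite -ob; apply: V_ev | apply: N_ev_exp].
Qed.

End Spanning.

(** * A chief series of a finite p-group *)

(** Any element outside K generates the group H / K of prime order. *)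
Lemma prime_index_gen (gT : finGroupType) (p : nat) (K H : {group gT}) (y : gT) :
    prime p -> K <| H -> #|H : K| = p -> y \in H -> y \notin K ->
  y ^+ p \in K /\ forall h, h \in H -> exists a t, t \in K /\ h = y ^+ a * t.
Proof.
move=> p_pr nKH iHK Hy Ky; have [_ nKH'] := andP nKH.
have oHK : #|H / K| = p by rewrite card_quotient.
have nKy := fintype.subsetP nKH' y Hy; have HKy := mem_quotient K Hy.
split.
  by apply: coset_idr; rewrite ?groupX // morphX // -oHK expg_cardG.
move=> h Hh; have nKh := fintype.subsetP nKH' h Hh.
have : H / K \subset <[coset K y]>.
  apply: prime_meetG; first by rewrite oHK.
  rewrite (finset.setIidPr _) ?cycle_subG // cycle_eq1.
  by apply: contra Ky => /eqP/coset_idr->.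
move/fintype.subsetP/(_ _ (mem_quotient K Hh))/cycleP => [a ha].
exists a, (y ^- a * h); rewrite mulKVg; split=> //.
apply: coset_idr; first by rewrite groupM ?groupV ?groupX.
by rewrite morphM ?groupV ?groupX // morphV ?groupX // morphX //= ha mulVg.
Qed.

(** H / K is normal of order p in the p-group G / K, so it meets the center and,
    having prime order, lies in it. *)
Lemma central_step (gT : finGroupType) (p : nat) (G K H : {group gT}) :
    prime p -> p.-group G -> K <| G -> H <| G -> K \subset H -> #|H : K| = p ->
  [~: H, G] \subset K.
Proof.
move=> p_pr pG nKG nHG sKH iHK; have [sKG nKG'] := andP nKG; have [sHG _] := andP nHG.
have oHK : #|H / K| = p by rewrite card_quotient // (fintype.subset_trans sHG).
rewrite -quotient_cents2 ?(fintype.subset_trans sHG) //.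
have : H / K \subset 'Z(G / K).
  apply: prime_meetG; first by rewrite oHK.
  apply: meet_center_nil; first exact: pgroup_nil (quotient_pgroup _ pG).
    exact: quotient_normal.
  by rewrite -cardG_gt1 oHK prime_gt1.
by rewrite finset.subsetI => /andP[].
Qed.

Lemma chief_chain (gT : finGroupType) (p n : nat) (G : {group gT}) :
    prime p -> p.-group G -> #|G| = (p ^ n)%N ->
  exists H : nat -> {group gT},
    [/\ H 0%N = 1%G, H n = G, forall m, H m <| G &
        forall m, (m < n)%N ->
          [/\ H m \subset H m.+1, #|H m.+1 : H m| = p & [~: H m.+1, G] \subset H m]].
Proof.
move=> p_pr pG oG.
suff chain m (Q : {group gT}) : Q <| G -> #|Q| = (p ^ m)%N ->
    exists H : nat -> {group gT},
    [/\ H 0%N = 1%G, H m = Q, forall k, H k <| G &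
        forall k, (k < m)%N ->
          [/\ H k \subset H k.+1, #|H k.+1 : H k| = p & [~: H k.+1, G] \subset H k]].
  by apply: chain.
elim: m Q => [|m IHm] Q nQ oQ.
  exists (fun=> 1%G); split=> // [|_]; last exact: normal1.
  by apply/val_inj/esym/card1_trivg; rewrite oQ.
have [|P [PQ nP oP]] := @normal_pgroup p gT m G Q pG nQ; first by rewrite oQ pfactorK.
have [H [H0 Hm nH HP]] := IHm P nP oP.
have iQP : #|Q : P| = p.
  by rewrite -divgS // oQ oP expnS mulnK // expn_gt0 prime_gt0.
exists (fun k => if (k <= m)%N then H k else Q); split=> [||k|k].
- by [].
- by rewrite ltnn.
- by case: ifP.
move=> km1; have [-> | nkm] := eqVneq k m.
  by rewrite leqnn ltnn Hm; split=> //; apply: central_step iQP.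
have km : (k < m)%N by rewrite ltn_neqAle nkm -ltnS.
by rewrite km (ltnW km); apply: HP.
Qed.

(** * The bound *)

Lemma covered_card (F : groupType) (A B : set F) (m : nat) :
  subgroup_set B -> covered A B m -> quotient_cosets A B #<= `I_m.
Proof.
move=> [B1 BM BV] [l lm Al].
apply: (@card_le_trans _ _ _ [set` l]); last first.
  apply: (@card_le_trans _ _ _ `I_(size l)); last by rewrite card_le_II.
  rewrite (_ : [set` l] = nth 1 l @` `I_(size l)); first exact: card_image_le.
  apply/seteqP; split=> [g gl | _ [a al <-]]; last exact: mem_nth.
  by exists (index g l); rewrite /= ?index_mem ?nth_index.
apply: (card_le_trans _ (card_image_le (fun g => [set g * b | b in B]) [set` l])).
apply: subset_card_le => _ [y /Al[g [b [gl Bb ->]]] <-]; exists g => //.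
apply/seteqP; split=> _ [d Bd <-].
  by exists (b^-1 * d); [apply: BM => //; apply: BV | rewrite mulgA mulgK].
by exists (b * d); [apply: BM | rewrite mulgA].
Qed.

Section Presentation.
Variables (p n : nat) (gT : finGroupType) (G : {group gT}).
Variables (F : groupType) (pi : {multiplicative F -> gT}) (H : nat -> {group gT}).
Hypotheses (p_pr : prime p) (pi_range : range pi = [set` G]).
Hypotheses (H0 : H 0%N = 1%G) (Hn : H n = G) (nH : forall m, H m <| G).
Hypothesis chain : forall m, (m < n)%N ->
  [/\ H m \subset H m.+1, #|H m.+1 : H m| = p & [~: H m.+1, G] \subset H m].

Definition preim (m : nat) : set F := [set y | pi y \in H m].

Lemma pi_in y : pi y \in G.
Proof. by have : range pi (pi y) by []; rewrite pi_range. Qed.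

Lemma pi_onto g : g \in G -> exists y, pi y = g.
Proof.
move=> Gg; suff [y _ <-] : range pi g by exists y.
by rewrite pi_range.
Qed.

Lemma pi1 : pi 1 = 1.
Proof. by apply: (mulgI (pi 1)); rewrite -gmulfM !mulg1. Qed.

Lemma piV y : pi y^-1 = (pi y)^-1.
Proof. by apply: (mulgI (pi y)); rewrite -gmulfM !mulgV pi1. Qed.

Lemma piX y a : pi (y ^+ a) = pi y ^+ a.
Proof. by elim: a => [|a IHa]; rewrite ?pi1 // !expgS gmulfM IHa. Qed.

Lemma pi_conj y z : pi (y ^ z) = pi y ^ pi z.
Proof. by rewrite !conjgE !gmulfM piV. Qed.

Lemma pi_comm y z : pi [~ y, z] = [~ pi y, pi z].
Proof. by rewrite !commgEl gmulfM piV pi_conj. Qed.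

Lemma normal_preim m : normal_set (preim m).
Proof.
split=> [|y z]; rewrite /preim /=.
  split=> /= [|y z Hy Hz|y Hy]; first by rewrite pi1.
    by rewrite gmulfM groupM.
  by rewrite piV groupV.
by move=> Hy; rewrite pi_conj memJ_norm // (fintype.subsetP (normal_norm (nH m))) ?pi_in.
Qed.

Lemma lift_exists : exists x : 'I_n -> F,
  forall j : 'I_n, pi (x j) \in H j.+1 /\ pi (x j) \notin H j.
Proof.
suff ex (j : 'I_n) : exists y, pi y \in H j.+1 /\ pi y \notin H j.
  by have [x xP] := choice ex; exists x.
have [sH iH _] := chain (ltn_ord j).
have : ~~ (H j.+1 \subset H j) by rewrite -indexg_eq1 iH neq_ltn prime_gt1 ?orbT.
case/fintype.subsetPn=> g Hg nHg.
have [y piy] := pi_onto (fintype.subsetP (normal_sub (nH j.+1)) g Hg).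
by exists y; rewrite piy.
Qed.

Variable x : 'I_n -> F.
Hypothesis xP : forall j : 'I_n, pi (x j) \in H j.+1 /\ pi (x j) \notin H j.

Lemma preim_mono m k : (m <= k <= n)%N -> preim m `<=` preim k.
Proof.
elim: k => [|k IHk] /andP[mk kn]; first by move: mk; rewrite leqn0 => /eqP->.
move: mk; rewrite leq_eqVlt => /predU1P[-> // | mk] y /IHk.
have [sH _ _] := chain kn; rewrite -ltnS mk ltnW // => /(_ isT).
exact: (fintype.subsetP sH).
Qed.

Lemma preim_comm m : (m < n)%N -> commutator_subgroup (preim m.+1) setT `<=` preim m.
Proof.
move=> mn; apply: commutator_min; first by case: (normal_preim m).
move=> y z Hy _; have [_ _ HG] := chain mn.
by rewrite /preim /= pi_comm (fintype.subsetP HG) // mem_commg // pi_in.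
Qed.

Lemma preim_exp (j : 'I_n) : preim j (x j ^+ p).
Proof.
have [Hx nHx] := xP j; have [sH iH _] := chain (ltn_ord j).
have nHH := normalS sH (normal_sub (nH j.+1)) (nH j).
by rewrite /preim /= piX; case: (prime_index_gen p_pr nHH iH Hx nHx).
Qed.

Lemma preim_gen (j : 'I_n) y : preim j.+1 y ->
  exists a t, preim j t /\ y = x j ^+ a * t.
Proof.
have [Hx nHx] := xP j; have [sH iH _] := chain (ltn_ord j).
have nHH := normalS sH (normal_sub (nH j.+1)) (nH j).
have [_ gen] := prime_index_gen p_pr nHH iH Hx nHx.
move=> /gen[a [t [Ht yt]]]; exists a, (x j ^- a * y); rewrite mulKVg; split=> //.
by rewrite /preim /= gmulfM piV piX yt mulKg.
Qed.

Lemma full_gen y : exists w r,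
  [/\ Defs.generated (range x) w, preim 0 r & y = w * r].
Proof.
suff gen m : (m <= n)%N -> forall z, preim m z -> exists w r,
    [/\ Defs.generated (range x) w, preim 0 r & z = w * r].
  by apply: (gen n) => //; rewrite /preim /= Hn pi_in.
have sX := @subgroup_generated F (range x); have [X1 XM _] := sX.
elim: m => [|m IHm] mn z; first by exists 1, z; rewrite mul1g.
move=> /(@preim_gen (Ordinal mn))[a [t [/(IHm (ltnW mn))[w [r [Xw Hr ->]]] ->]]].
exists (x (Ordinal mn) ^+ a * w), r; rewrite mulgA; split=> //.
by apply: XM => //; apply: (subgroup_exp a sX); apply: sub_generated; exists (Ordinal mn).
Qed.

(** At step m the brackets with least letter m join those with a smaller one. *)
Lemma covered_chain (le : rel (bracket n)) (k : nat) (L : seq (bracket n)) m :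
    commutator_order le -> (0 < k)%N ->
    (forall b, basic le b -> wt b = k -> b \in L) ->
    (forall b, b \in L -> wt b = k) -> (m <= n)%N ->
  covered (iterated_commutator (preim m) k.-1) (iterated_commutator (preim 0) k.-1)
    (p ^ count (fun b => least b < m)%N L).
Proof.
move=> le_order k0 L_all L_wt; have p0 := prime_gt0 p_pr.
elim: m => [_|m IHm mn]; first by apply: covered_refl; rewrite expn_gt0 p0.
have -> : count (fun b => least b < m.+1)%N L =
    (count (fun b => least b == m) L + count (fun b => least b < m) L)%N.
  rewrite -count_predUI [X in (_ + X)%N](_ : _ = 0%N).
    by rewrite addn0; apply: eq_count => b /=; rewrite ltnS leq_eqVlt.
  by rewrite (eq_count (a2 := pred0)) ?count_pred0 // => b /=; case: ltngtP.
rewrite expnD; apply: covered_trans (IHm (ltnW mn)).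
apply: (@covered_step n le le_order F x _ _ (Ordinal mn) _ _ _ _ _ (preim 0) p) => //=.
- exact: normal_preim.
- exact: normal_preim.
- by apply: preim_mono; rewrite leqnSn.
- exact: preim_comm.
- by have [] := xP (Ordinal mn).
- exact: normal_preim.
- by apply: preim_mono; rewrite leq0n (ltnW mn).
- exact: full_gen.
- exact: (@preim_gen (Ordinal mn)).
- exact: (preim_exp (Ordinal mn)).
move=> j jm; have [Hx _] := xP j; apply: (@preim_mono j.+1 m); last exact: Hx.
by rewrite jm (ltnW mn).
Qed.

End Presentation.

Lemma least_lt n (b : bracket n) : (least b < n)%N.
Proof. by elim: b => [j|u IHu v IHv] /=; rewrite ?gtn_min ?IHu. Qed.

Theorem corollary3p3 (p c n : nat) (gT : finGroupType) (G : {group gT})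
    (F : groupType) (pi : {multiplicative F -> gT}) (le : rel (bracket n)) :
  prime p -> (1 <= c)%N ->
  p.-group G -> #|G| = (p ^ n)%N ->
  free_presentation G pi ->
  commutator_order le ->
  nilpotent_multiplier c pi #<= `I_(p ^ chi le c.+1)%N.
Proof.
move=> p_pr _ pG oG [_ pi_range] le_order.
have [H [H0 Hn nH chain]] := chief_chain p_pr pG oG.
have [x xP] := lift_exists p_pr pi_range nH chain.
pose L : seq (bracket n) := fset_set (basic_commutators le c.+1).
have fin := basic_commutators_finite le c.+1.
have memL b : (b \in L) = (b \in basic_commutators le c.+1) by rewrite /L in_fset_set.
have kerE : hom_kernel pi = preim pi H 0.
  by apply/seteqP; split=> y; rewrite /preim /hom_kernel /= H0 => /set1P.
rewrite /nilpotent_multiplier kerE; apply: covered_card.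
  by case: (normal_iterated c (normal_preim pi_range nH 0)).
have -> : chi le c.+1 = count (fun b => least b < n)%N L.
  by rewrite (eq_count (a2 := predT)) ?count_predT // => b /=; rewrite least_lt.
apply: (@covered_subl _ _ (iterated_commutator (preim pi H n) c.+1.-1)).
  move=> y [_]; apply: iterated_mono => z _.
  by rewrite /preim /= Hn (pi_in pi_range).
apply: (covered_chain p_pr pi_range Hn nH chain xP le_order) => //.
  by move=> b bb bc; rewrite memL inE.
by move=> b; rewrite memL inE => -[].
Qed.
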